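(* Let $(\mathrm{P})$ be defined by an arbitrary $A\in\mathbb{Q}^{m\times n}$, $b\in\mathbb{Q}^m$ and $c\in\mathbb{Q}_+^n$. Let $\mathcal{J}$ be a partition of the index set $[n]$ of columns of $A$, let $G^{\mathrm{pack}}_{A,\mathcal{J}}=(V,E)$ be the packing interaction graph of $A$, and let $\mathcal{V}$ be a sparse cut support list, i.e. a collection of subsets of $V$, with $\bigcup_{V'\in\mathcal{V}}V'=V$. If the instance $(\mathrm{P})$ is feasible, then $$z^{\mathcal{V},P}\le\left(|V|+1-D_{\mathcal{V}}\right)\cdot z^I .$$
   Context: $[n]=\{1,\dots,n\}$. Problem $(\mathrm{P})$ is: maximize $c^Tx$ subject to $Ax\le b$, $x_j\in\mathbb{Z}_+$ for $j\in\mathcal{L}$, $x_j\in\mathbb{R}_+$ for $j\in[n]\setminus\mathcal{L}$, where $\mathcal{L}\subseteq[n]$; the entries of $A$ and $b$ may have any sign. Let $P$ be its feasible region, $P^I$ the convex hull of $P$, and $P^{LP}$ the feasible region of its linear programming relaxation. Sparse closures: for $N\subseteq[n]$, a sparse cut on $N$ is an inequality $\alpha^Tx\le\beta$ valid for $P^I$ with $\alpha_i=0$ for all $i\notin N$; $P^{(N)}$ is the set of points of $P^{LP}$ satisfying all sparse cuts on $N$. For a partition $\mathcal{J}=\{J_1,\dots,J_q\}$ of $[n]$, the packing interaction graph $G^{\mathrm{pack}}_{A,\mathcal{J}}$ has one node $v_j$ for each block $J_j$, and distinct nodes $v_i,v_j$ are adjacent iff some row of $A$ has a nonzero entry in a column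 of $J_i$ and a nonzero entry in a column of $J_j$. For $S\subseteq V$ put $P^{(S)}:=P^{(\bigcup_{v_j\in S}J_j)}$, and $P^{\mathcal{V},P}:=\bigcap_{S\in\mathcal{V}}P^{(S)}$. Set $z^I=\max\{c^Tx:x\in P^I\}$ and $z^{\mathcal{V},P}=\max\{c^Tx:x\in P^{\mathcal{V},P}\}$. Corrected average density: for a nonempty subcollection $\tilde{\mathcal{V}}=\{V^{u_1},\dots,V^{u_k}\}\subseteq\mathcal{V}$ let $D(\tilde{\mathcal{V}})=\frac1k\sum_{i=1}^k|V^{u_i}|$. Then $D_{\mathcal{V}}$ is the maximum of $D(\tilde{\mathcal{V}})$ over all $\tilde{\mathcal{V}}\subseteq\mathcal{V}$ with $\bigcup_{V'\in\tilde{\mathcal{V}}}V'=V$. *)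

(* Defs.v *)
From HB Require Import structures.
From mathcomp Require Import all_boot all_order all_algebra.
From mathcomp Require Import all_classical all_reals all_analysis.

Set Implicit Arguments.
Unset Strict Implicit.
Unset Printing Implicit Defensive.

Import Order.TTheory GRing.Theory Num.Theory.
Local Open Scope classical_set_scope.
Local Open Scope ring_scope.

Definition dotp (R : realType) (n : nat) (a x : 'cV[R]_n) : R :=
  (a^T *m x) 0 0.

(* The data are rational and the points are real; [ratr] embeds the data. *)
Definition lp_region (R : realType) (m n : nat) (A : 'M[rat]_(m, n))
    (b : 'cV[rat]_m) : set 'cV[R]_n :=
  [set x | (forall i, (map_mx ratr A *m x) i 0 <= ratr (b i 0)) /\
           (forall j, 0 <= x j 0)].

Definition feasible_region (R : realType) (m n : nat) (A : 'M[rat]_(m, n))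
    (b : 'cV[rat]_m) (L : {set 'I_n}) : set 'cV[R]_n :=
  [set x | lp_region A b x /\ forall j, j \in L -> x j 0 \is a Num.nat].

Definition convex_hull (R : realType) (n : nat) (X : set 'cV[R]_n) :
    set 'cV[R]_n :=
  smallest (@convex_set R 'cV[R]_n) X.

Definition integer_hull (R : realType) (m n : nat) (A : 'M[rat]_(m, n))
    (b : 'cV[rat]_m) (L : {set 'I_n}) : set 'cV[R]_n :=
  convex_hull (feasible_region A b L).

Definition sparse_cut (R : realType) (m n : nat) (A : 'M[rat]_(m, n))
    (b : 'cV[rat]_m) (L N : {set 'I_n}) (alpha : 'cV[R]_n) (beta : R) : Prop :=
  (forall x, integer_hull A b L x -> dotp alpha x <= beta) /\
  (forall j, j \notin N -> alpha j 0 = 0).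

Definition sparse_closure (R : realType) (m n : nat) (A : 'M[rat]_(m, n))
    (b : 'cV[rat]_m) (L N : {set 'I_n}) : set 'cV[R]_n :=
  [set x | lp_region A b x /\
           forall alpha beta, sparse_cut A b L N alpha beta ->
                              dotp alpha x <= beta].

(* The value max {c^T x : x in X} in the extended reals: it is the maximum
   whenever that is attained, and +oo if the objective is unbounded on X. *)
Definition opt_value (R : realType) (n : nat) (c : 'cV[rat]_n)
    (X : set 'cV[R]_n) : \bar R :=
  ereal_sup [set (dotp (map_mx ratr c) x)%:E | x in X].

Record sgraph := SGraph {
  vertex :> finType;
  adj : rel vertex;
  adj_sym : symmetric adj;
  adj_irrefl : irreflexive adj }.

(* The blocks J_1, ..., J_q are indexed by 'I_q without repetition;
   [partition] includes that they are nonempty. *)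
Definition is_block_partition (n q : nat) (J : 'I_q -> {set 'I_n}) : Prop :=
  injective J /\ finset.partition [set J u | u : 'I_q]%SET [set: 'I_n]%SET.

Definition pack_adj (m n q : nat) (A : 'M[rat]_(m, n))
    (J : 'I_q -> {set 'I_n}) : rel 'I_q :=
  fun u v => (u != v) &&
    [exists i, [exists j in J u, A i j != 0] && [exists k in J v, A i k != 0]].

Lemma pack_adj_sym m n q (A : 'M[rat]_(m, n)) (J : 'I_q -> {set 'I_n}) :
  symmetric (pack_adj A J).
Proof.
move=> u v; rewrite /pack_adj eq_sym; congr andb.
by apply: eq_existsb => i; rewrite andbC.
Qed.

Lemma pack_adj_irrefl m n q (A : 'M[rat]_(m, n)) (J : 'I_q -> {set 'I_n}) :
  irreflexive (pack_adj A J).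
Proof. by move=> u; rewrite /pack_adj eqxx. Qed.

(* The node v_j is the index j of the block J_j. *)
Definition pack_graph (m n q : nat) (A : 'M[rat]_(m, n))
    (J : 'I_q -> {set 'I_n}) : sgraph :=
  SGraph (pack_adj_sym A J) (pack_adj_irrefl A J).

Definition node_columns (m n q : nat) (A : 'M[rat]_(m, n))
    (J : 'I_q -> {set 'I_n}) (S : {set pack_graph A J}) : {set 'I_n} :=
  (\bigcup_(v in S) J v)%SET.

Definition support_closure (R : realType) (m n q : nat) (A : 'M[rat]_(m, n))
    (b : 'cV[rat]_m) (L : {set 'I_n}) (J : 'I_q -> {set 'I_n})
    (VV : {set {set pack_graph A J}}) : set 'cV[R]_n :=
  \bigcap_(S in [set` VV]) sparse_closure A b L (node_columns S).

Definition avg_density (R : realType) (V : finType) (W : {set {set V}}) : R :=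
  (\sum_(S in W) #|S|%:R) / #|W|%:R.

(* Densities are nonnegative, so the default value 0 of the iterated maximum
   matters only if no nonempty subcollection of VV covers V. *)
Definition corrected_density (R : realType) (V : finType)
    (VV : {set {set V}}) : R :=
  \big[Num.max/0]_(W : {set {set V}} |
      [&& W \subset VV, W != finset.set0 & finset.cover W == [set: V]%SET])
    avg_density R W.

(* Main.v *)
(** Because [c] and the points are nonnegative, restricting the objective to the
   columns of some [S] in [VV] gives a sparse cut on [S] with right-hand side
   [z^I].  Fix [S] in [VV]; the nodes outside [S] lie in at most [|V| - |S|]
   further members of [VV], so at most [|V| + 1 - |S|] such cuts cover the whole
   objective.  Some member of any subcollection is at least as large as the
   average, hence [S] can be chosen with [|S| >= D_VV]. *)
Require Import Defs.
From mathcomp Require Import all_boot all_order all_algebra.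
From mathcomp Require Import all_classical all_reals all_analysis.
From mathcomp Require Import lra.

Local Open Scope classical_set_scope.
Local Open Scope ring_scope.

Set Implicit Arguments.
Unset Strict Implicit.
Unset Printing Implicit Defensive.

Import Order.TTheory GRing.Theory Num.Theory.

(** Kept as a sum over [N], so that it splits over disjoint column sets. *)
Definition partial_dot (R : realType) (n : nat) (a : 'cV[R]_n)
    (N : {set 'I_n}) (x : 'cV[R]_n) : R :=
  \sum_(j in N) a j 0 * x j 0.

Lemma dotpE (R : realType) (n : nat) (a x : 'cV[R]_n) :
  dotp a x = \sum_j a j 0 * x j 0.
Proof. by rewrite /dotp mxE; apply: eq_bigr => j _; rewrite mxE. Qed.

Lemma dotp_restrict (R : realType) (n : nat) (a x : 'cV[R]_n)
    (N : {set 'I_n}) :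
  dotp (\col_j (if j \in N then a j 0 else 0)) x = partial_dot a N x.
Proof.
rewrite dotpE /partial_dot [RHS]big_mkcond; apply: eq_bigr => j _.
by rewrite mxE; case: ifP => // _; rewrite mul0r.
Qed.

Lemma partial_dot_subset (R : realType) (n : nat) (a x : 'cV[R]_n)
    (M N : {set 'I_n}) :
  (forall j, 0 <= a j 0) -> (forall j, 0 <= x j 0) -> M \subset N ->
  partial_dot a M x <= partial_dot a N x.
Proof.
move=> a0 x0 /fintype.subsetP MN.
rewrite /partial_dot [leLHS]big_mkcond [leRHS]big_mkcond /=.
apply: ler_sum => j _; case: ifP => [/MN ->//|_].
by case: ifP => // _; rewrite mulr_ge0.
Qed.

Lemma partial_dot_setT (R : realType) (n : nat) (a x : 'cV[R]_n) :
  partial_dot a [set: 'I_n]%SET x = dotp a x.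
Proof. by rewrite dotpE; apply: eq_bigl => j; rewrite finset.in_setT. Qed.

(** The nonnegative orthant is convex and contains the feasible region, hence also its hull. *)
Lemma integer_hull_ge0 (R : realType) (m n : nat) (A : 'M[rat]_(m, n))
    (b : 'cV[rat]_m) (L : {set 'I_n}) (x : 'cV[R]_n) :
  integer_hull A b L x -> forall j, 0 <= x j 0.
Proof.
move: x; apply: smallest_sub => [y z t|y [[_ y0] _]]; last exact: y0.
rewrite !inE => y0 z0 j.
rewrite !mxE; apply: addr_ge0; apply: mulr_ge0 => //.
by rewrite unstable.onem_ge0.
Qed.

(** Truncating [a] to [N] can only lower its value at the nonnegative points of the hull, so the
    truncated vector with right-hand side [z] is a sparse cut on [N]. *)
Lemma sparse_closure_partial_dot (R : realType) (m n : nat)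
    (A : 'M[rat]_(m, n)) (b : 'cV[rat]_m) (L N : {set 'I_n})
    (a x : 'cV[R]_n) (z : R) :
  (forall j, 0 <= a j 0) ->
  (forall y, integer_hull A b L y -> dotp a y <= z) ->
  sparse_closure A b L N x -> partial_dot a N x <= z.
Proof.
move=> a0 az [_ cuts]; rewrite -dotp_restrict; apply: cuts; split.
  move=> y Py; apply: le_trans (az y Py).
  rewrite dotp_restrict -partial_dot_setT.
  apply: partial_dot_subset (finset.subsetT _) => //.
  exact: integer_hull_ge0 Py.
by move=> j /negbTE jN; rewrite mxE jN.
Qed.

(** The blocks are pairwise disjoint, and injectivity of [J] lets the sum over blocks be indexed by
    nodes. *)
Lemma partial_dot_bigcup (R : realType) (m n q : nat) (A : 'M[rat]_(m, n))
    (J : 'I_q -> {set 'I_n}) (a x : 'cV[R]_n) (S : {set pack_graph A J}) :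
  is_block_partition J ->
  partial_dot a (node_columns S) x = \sum_(v in S) partial_dot a (J v) x.
Proof.
move=> [injJ /and3P[_ trivJ _]]; rewrite /node_columns -finset.cover_imset.
rewrite /partial_dot finset.big_trivIset ?big_imset //=.
  by move=> u v _ _ /injJ.
by apply: finset.trivIsetS trivJ; apply/fintype.subsetP => _ /imsetP[v _ ->]; exact: imset_f.
Qed.

Lemma node_columns_setT (m n q : nat) (A : 'M[rat]_(m, n))
    (J : 'I_q -> {set 'I_n}) :
  is_block_partition J ->
  node_columns [set: pack_graph A J]%SET = [set: 'I_n]%SET.
Proof.
move=> [_ /and3P[/eqP <- _ _]]; rewrite finset.cover_imset /node_columns.
by apply: eq_bigl => v; rewrite !inE.
Qed.

(** A member of maximum cardinality is at least as large as the average. *)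
Lemma le_avg_density (R : realType) (V : finType) (W : {set {set V}}) :
  W != finset.set0 -> exists2 S, S \in W & avg_density R W <= #|S|%:R.
Proof.
move=> /finset.set0Pn[S0 S0W].
case: (arg_maxnP (fun S : {set V} => #|S|) S0W) => S SW maxS.
exists S => //; rewrite /avg_density ler_pdivrMr; last first.
  by rewrite ltr0n; apply/card_gt0P; exists S.
rewrite mulr_natr -sumr_const; apply: ler_sum => T TW.
by rewrite ler_nat; exact: maxS.
Qed.

(** The left case is the default value of the iterated maximum, which comes with no witness [S]. *)
Lemma le_corrected_density (R : realType) (V : finType)
    (VV : {set {set V}}) :
  corrected_density R VV = 0 \/
  exists2 S, S \in VV & corrected_density R VV <= #|S|%:R.
Proof.
rewrite /corrected_density; elim/big_ind: _ => [|d e Hd He|W /and3P[WV W0 _]].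
- by left.
- by rewrite /Num.max; case: ifP.
- have [S SW le_S] := @le_avg_density R V W W0.
  by right; exists S => //; exact: (fintype.subsetP WV).
Qed.

Lemma corrected_density_le_card (R : realType) (V : finType)
    (VV : {set {set V}}) :
  corrected_density R VV <= #|V|%:R.
Proof.
have [->|[S _ le_S]] := @le_corrected_density R V VV; first exact: ler0n.
by apply: le_trans le_S _; rewrite ler_nat max_card.
Qed.

Section SupportClosure.
Variables (R : realType) (m n q : nat) (A : 'M[rat]_(m, n)) (b : 'cV[rat]_m).
Variables (L : {set 'I_n}) (J : 'I_q -> {set 'I_n}).
Variables (VV : {set {set pack_graph A J}}) (a x : 'cV[R]_n) (z : R).
Hypothesis partJ : is_block_partition J.
Hypothesis coverVV : finset.cover VV = [set: pack_graph A J]%SET.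
Hypothesis a_ge0 : forall j, 0 <= a j 0.
Hypothesis z_ge0 : 0 <= z.
Hypothesis hull_le : forall y, integer_hull A b L y -> dotp a y <= z.
Hypothesis Px : support_closure b L VV x.

(** Some member of [VV] contains [v]; its cut bounds the objective on a column set that includes
    [J v]. *)
Lemma support_closure_block (v : pack_graph A J) :
  partial_dot a (J v) x <= z.
Proof.
have /bigcupP[S SV vS] : v \in finset.cover VV by rewrite coverVV inE.
have PS := Px SV.
apply: le_trans (sparse_closure_partial_dot a_ge0 hull_le PS).
apply: partial_dot_subset => //; first by case: PS => -[].
exact: finset.bigcup_sup.
Qed.

Lemma support_closure_dotp_card :
  dotp a x <= #|pack_graph A J|%:R * z.
Proof.
rewrite -partial_dot_setT -(node_columns_setT A partJ) partial_dot_bigcup //.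
rewrite -cardsT mulr_natl -sumr_const; apply: ler_sum => v _.
exact: support_closure_block.
Qed.

(** One cut handles all of [S] at once, and each node outside [S] costs one more [z]. *)
Lemma support_closure_dotp_support (S : {set pack_graph A J}) :
  S \in VV -> dotp a x <= (#|pack_graph A J|%:R + 1 - #|S|%:R) * z.
Proof.
move=> SV; rewrite -partial_dot_setT -(node_columns_setT A partJ).
rewrite partial_dot_bigcup // (finset.big_setID S) /= finset.setTI.
rewrite -partial_dot_bigcup // finset.setTD.
have leS := sparse_closure_partial_dot a_ge0 hull_le (Px SV).
have leSC : \sum_(v in (~: S)%SET) partial_dot a (J v) x <= #|(~: S)%SET|%:R * z.
  rewrite mulr_natl -sumr_const; apply: ler_sum => v _.
  exact: support_closure_block.
(* Splitting the node count into [S] and its complement turns the factor into the size of the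
   complement plus one. *)
rewrite -(finset.cardsC S) natrD; lra.
Qed.

Lemma support_closure_dotp :
  dotp a x <= (#|pack_graph A J|%:R + 1 - corrected_density R VV) * z.
Proof.
have [->|[S SV leS]] := @le_corrected_density R _ VV.
  (* At density 0 the factor is the node count plus one, so one [z] per node suffices. *)
  apply: le_trans support_closure_dotp_card _.
  by rewrite ler_wpM2r // subr0 lerDl.
apply: le_trans (support_closure_dotp_support SV) _.
by rewrite ler_wpM2r // lerD2l lerN2.
Qed.

End SupportClosure.

Theorem theorem26 (R : realType) (m n q : nat)
    (A : 'M[rat]_(m, n)) (b : 'cV[rat]_m) (c : 'cV[rat]_n) (L : {set 'I_n})
    (J : 'I_q -> {set 'I_n}) (VV : {set {set pack_graph A J}}) :
  (forall j, 0 <= c j 0) ->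
  is_block_partition J ->
  finset.cover VV = [set: pack_graph A J]%SET ->
  feasible_region (R := R) A b L !=set0 ->
  (opt_value c (support_closure (R := R) b L VV)
   <= (#|pack_graph A J|%:R + 1 - corrected_density R VV)%:E
      * opt_value c (integer_hull (R := R) A b L))%E.
Proof.
move=> c0 partJ coverVV [x0 Fx0].
have a0 j : 0 <= (map_mx (@ratr R) c) j 0 by rewrite mxE ler0q.
have hull_le y : integer_hull A b L y ->
    ((dotp (map_mx ratr c) y)%:E
     <= opt_value c (integer_hull (R := R) A b L))%E.
  by move=> Py; apply: ereal_sup_ubound; exists y.
have Px0 : integer_hull A b L x0 by apply: sub_smallest Fx0.
have x0_ge0 : 0 <= dotp (map_mx ratr c) x0.
  rewrite dotpE; apply: sumr_ge0 => j _; rewrite mulr_ge0 //.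
  exact: integer_hull_ge0 Px0 _.
(* Feasibility enters here: it excludes the value [-oo] of an empty supremum. *)
have z_ge0 : (0 <= opt_value c (integer_hull (R := R) A b L))%E.
  by apply: le_trans (hull_le _ Px0); rewrite lee_fin.
(* Strict positivity matters when the optimum is [+oo]: a zero factor would make the product 0. *)
have k_gt0 : 0 < #|pack_graph A J|%:R + 1 - corrected_density R VV.
  have := @corrected_density_le_card R _ VV; lra.
case: opt_value hull_le z_ge0 => [z| |] hull_le z_ge0 //; last first.
  by rewrite gt0_muley ?lte_fin // leey.
apply: ge_ereal_sup => _ [x Px <-]; rewrite -EFinM lee_fin.
exact: (support_closure_dotp partJ coverVV a0 _ hull_le Px).
Qed.
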